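(* Let $f\colon H_1\to H_2$ be a continuous map between Heyting semilattices, with left adjoint $f^*\colon H_2\to H_1$. The following are equivalent: (i) $f$ is open. (ii) $f$ is basic open (as a basic continuous map $(H_1,\mathfrak{c}H_1,\mathcal{B}d(H_1))\to(H_2,\mathfrak{c}H_2,\mathcal{B}d(H_2))$). (iii) The map $f_{\leftarrow}^{\mathfrak{o}}\colon\mathfrak{o}H_2\to\mathfrak{o}H_1$, $\mathfrak{o}b\mapsto f_{\leftarrow}[\mathfrak{o}b]$, has a left adjoint $h\colon\mathfrak{o}H_1\to\mathfrak{o}H_2$ such that $h[\mathfrak{o}a\cap f_{\leftarrow}[\mathfrak{o}b]]=h[\mathfrak{o}a]\cap\mathfrak{o}b$ for every $a\in H_1$ and $b\in H_2$. (iv) $f^*$ has a left adjoint $f_!\colon H_1\to H_2$ such that $f_!(a\wedge f^*(b))=f_!(a)\wedge b$ for every $a\in H_1$ and $b\in H_2$. (v) $f^*$ is a right adjoint such that $f^*(b\to c)=f^*(b)\to f^*(c)$ for every $b,c\in H_2$.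
   Context: A Heyting semilattice is a meet-semilattice $H$ with top $1$ and a binary operation $\to$ satisfying $a\wedge b\le c\Leftrightarrow b\le a\to c$. A map between Heyting semilattices is continuous if it has a left adjoint that preserves finite meets (including the top element). For $a\in H$: $\mathfrak{o}a=\{a\to x\mid x\in H\}$ and $\mathfrak{c}a=\{x\in H\mid x\ge a\}$; $\mathfrak{o}H=\{\mathfrak{o}a\mid a\in H\}$ and $\mathfrak{c}H=\{\mathfrak{c}a\mid a\in H\}$, ordered by inclusion. A continuous map $f\colon H_1\to H_2$ is open if $f[\mathfrak{o}a]\in\mathfrak{o}H_2$ for every $a\in H_1$. An ideal of $H$ is a subset $T\subseteq H$ containing $1$, closed under binary meets, and such that $x\to t\in T$ for all $x\in H$, $t\in T$; the set $\mathcal{I}dl(H)$ of ideals, ordered by inclusion, is a complete distributive lattice with intersections as meets. All $\mathfrak{c}a,\mathfrak{o}a$ are ideals and are complements of each other. $\mathcal{B}d(H)$ (basic domains of $H$) is the set of all subsets of the form $\bigcap_{i\in J}(\mathfrak{c}a_i^1\vee\mathfrak{o}b_i^1\vee\dots\vee\mathfrak{c}a_i^{n_i}\vee\mathfrak{o}b_i^{n_i})$ with joins taken in $\mathcal{I}dl(H)$. The triple $(H,\mathfrak{c}H,\mathcal{B}d(H))$ is a b0-space in the following sense, with complements $\neg\mathfrak{c}a=\mathfrak{o}a$, open domains $\mathfrak{o}H$ and bottom $\{1\}$. A basic zero-dimensional space (b0-space) is a triple $\mathcal{S}=(X,\mathcal{C},\mathcal{B}d)$ where $X$ is a set, $\mathcal{B}d$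 is a closure system on $X$ (contains $X$, closed under arbitrary intersections) that is distributive as a lattice (joins $\vee$ in $\mathcal{B}d$ being the least members containing the union), and $\mathcal{C}\subseteq\mathcal{B}d$ is such that every $C\in\mathcal{C}$ has a complement $\neg C$ in $\mathcal{B}d$, and every $M\in\mathcal{B}d$ is an intersection of finite joins of elements $C\vee\neg D$ with $C,D\in\mathcal{C}$. Its open domains are the elements $\neg C$, $C\in\mathcal{C}$; its bottom is denoted $\mathsf{O}$. A basic continuous map $f\colon(X,\mathcal{C}_X,\mathcal{B}d_X)\to(Y,\mathcal{C}_Y,\mathcal{B}d_Y)$ is a map $f\colon X\to Y$ such that: $f^{-1}[\mathsf{O}]=\mathsf{O}$; there is a map $f_{\leftarrow}^{\mathfrak{c}}\colon\mathcal{C}_Y\to\mathcal{C}_X$ with $f[B]\subseteq C$ iff $B\subseteq f_{\leftarrow}^{\mathfrak{c}}[C]$ for all $B\in\mathcal{C}_X$, $C\in\mathcal{C}_Y$; $\neg f_{\leftarrow}^{\mathfrak{c}}[C]\subseteq f^{-1}[\neg C]$ for all $C\in\mathcal{C}_Y$; and $\bigvee_{i=1}^n(f_{\leftarrow}^{\mathfrak{c}}[C_i]\vee\neg f_{\leftarrow}^{\mathfrak{c}}[D_i])\subseteq f^{-1}[\bigvee_{i=1}^n(C_i\vee\neg D_i)]$ for all $C_i,D_i\in\mathcal{C}_Y$. The basic image is $f_{\rightarrow}[M]=\bigcap\{S\in\mathcal{B}d_Y\mid f[M]\subseteq S\}$ for $M\in\mathcal{B}d_X$; it has a right adjoint $f_{\leftarrow}\colon\mathcal{B}d_Y\to\mathcal{B}d_X$,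 the basic preimage. $f$ is basic open if $f_{\rightarrow}$ sends open domains to open domains. Every continuous map $f\colon H_1\to H_2$ of Heyting semilattices is basic continuous between the associated b0-spaces, and $f_{\leftarrow}[\mathfrak{o}b]=\mathfrak{o}(f^*(b))$. *)

(* Defs.v *)
From HB Require Import structures.
From mathcomp Require Import all_boot all_order.
From mathcomp Require Import boolp classical_sets.

Set Implicit Arguments.
Unset Strict Implicit.
Unset Printing Implicit Defensive.

Import Order.TTheory.
Local Open Scope classical_set_scope.
Local Open Scope order_scope.

Section ClosureSystems.
Variable X : Type.
Implicit Types (L F : set (set X)) (M N C : set X).

(* The case F = set0 says that the whole set belongs to L. *)
Definition closure_system L :=
  forall F, (F `<=` L)%classic -> L (\bigcap_(S in F) S).

Definition join L M N : set X := smallest L (M `|` N)%classic.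
Definition bigjoin L (I : Type) (F : I -> set X) : set X :=
  smallest L (\bigcup_i F i).
Definition bottom L : set X := smallest L set0.

Definition distributive L := forall M N P, L M -> L N -> L P ->
  (M `&` join L N P)%classic = join L (M `&` N)%classic (M `&` P)%classic.

Definition is_complement L C : set (set X) :=
  [set N | [/\ L N, (C `&` N)%classic = bottom L & join L C N = setT]].

(* Complements are unique in a distributive L (lemma complE); the value is
   meaningless if C has no complement. *)
Definition compl L C : set X := xget setT (is_complement L C).

End ClosureSystems.

Record b0Space := B0Space {
  b0_points :> Type;
  closed_domain : set (set b0_points);
  basic_domain : set (set b0_points);
  b0_closure_system : closure_system basic_domain;
  b0_distributive : distributive basic_domain;
  b0_closed_basic : (closed_domain `<=` basic_domain)%classic;
  b0_complemented :
    forall C, closed_domain C -> exists N, is_complement basic_domain C N;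
  b0_generated : forall M, basic_domain M ->
    exists2 F : set (set b0_points), M = \bigcap_(S in F) S &
      forall S, F S -> exists (n : nat) (C D : 'I_n -> set b0_points),
        [/\ forall i, closed_domain (C i), forall i, closed_domain (D i) &
            S = bigjoin basic_domain
                  (fun i => join basic_domain (C i) (compl basic_domain (D i)))]
}.

Section B0Maps.
Variables S T : b0Space.

Definition neg (U : b0Space) (C : set U) : set U := compl (@basic_domain U) C.

Definition open_domain (U : b0Space) : set (set U) :=
  @neg U @` @closed_domain U.

Definition basic_continuous (f : S -> T) :=
  f @^-1` bottom (@basic_domain T) = bottom (@basic_domain S) /\
  exists g : set T -> set S,
    [/\ forall C, @closed_domain T C -> @closed_domain S (g C),
        forall B C, @closed_domain S B -> @closed_domain T C ->
          (f @` B `<=` C <-> B `<=` g C)%classic,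
        forall C, @closed_domain T C -> (neg (g C) `<=` f @^-1` neg C)%classic &
        forall (n : nat) (C D : 'I_n -> set T),
          (forall i, @closed_domain T (C i)) ->
          (forall i, @closed_domain T (D i)) ->
          (bigjoin (@basic_domain S)
             (fun i => join (@basic_domain S) (g (C i)) (neg (g (D i)))) `<=`
           f @^-1` bigjoin (@basic_domain T)
             (fun i => join (@basic_domain T) (C i) (neg (D i))))%classic].

Record basicMap := BasicMap {
  basic_fun :> S -> T;
  basic_funP : basic_continuous basic_fun
}.

Definition basic_image (f : basicMap) (M : set S) : set T :=
  smallest (@basic_domain T) (f @` M).

(* The right adjoint of basic_image f, computed as the join of all basic
   domains M with f_->[M] contained in N; see basic_preimage_adjunction. *)
Definition basic_preimage (f : basicMap) (N : set T) : set S :=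
  smallest (@basic_domain S)
    (\bigcup_(M in [set M | @basic_domain S M /\
                            (basic_image f M `<=` N)%classic]) M).

Definition basic_open (f : basicMap) :=
  forall U, @open_domain S U -> @open_domain T (basic_image f U).

End B0Maps.

(* l : P -> Q is left adjoint to r : Q -> P, for families of sets P and Q
   ordered by inclusion; l and r are only relevant on P and Q. *)
Definition set_adjunction (X Y : Type) (P : set (set X)) (Q : set (set Y))
    (l : set X -> set Y) (r : set Y -> set X) :=
  [/\ forall A, P A -> Q (l A), forall B, Q B -> P (r B) &
      forall A B, P A -> Q B -> (l A `<=` B <-> A `<=` r B)%classic].

HB.mixin Record TMeetSemilattice_isHeyting (d : Order.disp_t) H
    of Order.TMeetSemilattice d H := {
  himp : H -> H -> H;
  himpP : forall a b c : H, ((a `&` b)%O <= c) = (b <= himp a c)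
}.

#[short(type="heytingSemilatticeType")]
HB.structure Definition HeytingSemilattice d :=
  { H of Order.TMeetSemilattice d H & TMeetSemilattice_isHeyting d H }.

Definition adjoint d1 d2 (P : porderType d1) (Q : porderType d2)
    (l : P -> Q) (r : Q -> P) := forall x y, (l x <= y) = (x <= r y).

Section HeytingSets.
Context {d : Order.disp_t} {H : heytingSemilatticeType d}.
Implicit Types (a b : H) (T : set H).

Definition hs_open_set a : set H := range (himp a).
Definition hs_closed_set a : set H := [set x | a <= x].

Definition ideal : set (set H) := [set T | [/\ T \top,
  forall x y, T x -> T y -> T (x `&` y)%O & forall x t, T t -> T (himp x t)]].

(* n = 0 gives the bottom ideal, which is hs_basic in any case: it is the
   intersection of all o b. *)
Definition hs_elementary : set (set H) :=
  [set S | exists (n : nat) (a b : 'I_n -> H),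
    S = bigjoin ideal
          (fun i => join ideal (hs_closed_set (a i)) (hs_open_set (b i)))].

End HeytingSets.

Section HeytingFamilies.
Context {d : Order.disp_t} (H : heytingSemilatticeType d).

Definition hs_opens : set (set H) := range hs_open_set.
Definition hs_closeds : set (set H) := range hs_closed_set.

Definition hs_basic : set (set H) :=
  [set M | exists2 F : set (set H), (F `<=` hs_elementary)%classic &
                                    M = \bigcap_(S in F) S].

End HeytingFamilies.

Arguments hs_opens {d} H _ : rename.
Arguments hs_closeds {d} H _ : rename.
Arguments hs_basic {d} H _ : rename.

Section HeytingMaps.
Context {d1 d2 : Order.disp_t}.
Variables (H1 : heytingSemilatticeType d1) (H2 : heytingSemilatticeType d2).

Definition hs_continuous (f : H1 -> H2) := exists fs : H2 -> H1,
  [/\ adjoint fs f, fs \top = \top & {morph fs : x y / (x `&` y)%O}].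

Definition hs_open (f : H1 -> H2) :=
  forall a, hs_opens H2 (f @` hs_open_set a).

End HeytingMaps.

Section ClosureSystemTheory.
Variables (X : Type) (L : set (set X)).
Hypothesis (Lcl : closure_system L).
Implicit Types (M N P C R : set X).
Local Open Scope classical_set_scope.

Lemma cs_smallest G : L (smallest L G).
Proof. by apply: Lcl => S []. Qed.

Lemma cs_setT : L setT.
Proof. by have := Lcl (@sub0set _ L); rewrite bigcap_set0. Qed.

Lemma cs_bigcap I (D : set I) (F : I -> set X) :
  (forall i, D i -> L (F i)) -> L (\bigcap_(i in D) F i).
Proof.
move=> LF; rewrite -(bigcap_image D F id).
by apply: Lcl => _ [i Di <-]; exact: LF.
Qed.

Lemma cs_setI M N : L M -> L N -> L (M `&` N).
Proof.
by move=> LM LN; rewrite -bigcap2E; apply: cs_bigcap => -[|[|i]] _ //=;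
   exact: cs_setT.
Qed.

Lemma bottom_sub M : L M -> bottom L `<=` M.
Proof. by move=> LM; apply: smallest_sub => // ? []. Qed.

Lemma join_subP M N P : L P -> (join L M N `<=` P) <-> (M `<=` P /\ N `<=` P).
Proof.
move=> LP; split=> [h|[hM hN]].
  split; apply: subset_trans h; apply: sub_smallest.
    exact: subsetUl.
  exact: subsetUr.
by apply: smallest_sub => //; rewrite subUset.
Qed.

Lemma join_subl M N : M `<=` join L M N.
Proof. by apply: sub_smallest; exact: subsetUl. Qed.

Lemma join_subr M N : N `<=` join L M N.
Proof. by apply: sub_smallest; exact: subsetUr. Qed.

Lemma joinC M N : join L M N = join L N M.
Proof. by rewrite /join setUC. Qed.

Lemma bigjoin_subP I (F : I -> set X) P : L P ->
  (bigjoin L F `<=` P) <-> (forall i, F i `<=` P).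
Proof.
move=> LP; split=> [h i|h].
  by apply: subset_trans h; apply: sub_smallest; exact: bigcup_sup.
by apply: smallest_sub => //; apply: bigcup_sub.
Qed.

Lemma bigjoin_sup I (F : I -> set X) i : F i `<=` bigjoin L F.
Proof. by apply: sub_smallest; exact: bigcup_sup. Qed.

Hypothesis (Ldist : distributive L).

Lemma complement_uniq C N N' : L C ->
  is_complement L C N -> is_complement L C N' -> N = N'.
Proof.
move=> LC [LN CN jN] [LN' CN' jN'].
have aux A B : L A -> L B -> C `&` A = bottom L -> join L C B = setT -> A `<=` B.
  move=> LA LB CA jB; have := Ldist LA LC LB.
  rewrite jB setIT => ->; apply/(join_subP _ _ LB); split; last exact: subIsetr.
  by rewrite setIC CA; exact: bottom_sub.
by apply/seteqP; split; apply: aux.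
Qed.

Lemma complE C N : L C -> is_complement L C N -> compl L C = N.
Proof.
by move=> LC cN; apply: xget_unique => // N' cN'; apply: complement_uniq cN.
Qed.

Lemma complP C : (exists N, is_complement L C N) ->
  is_complement L C (compl L C).
Proof. by move=> ex; apply: xgetPex. Qed.

Lemma joinIr R M N : L R -> L M -> L N ->
  join L R M `&` join L R N `<=` join L R (M `&` N).
Proof.
move=> LR LM LN; have LJ := cs_smallest (R `|` (M `&` N)).
rewrite (Ldist (cs_smallest _) LR LN); apply/(join_subP _ _ LJ); split.
  by apply: subset_trans (@join_subl R (M `&` N)); exact: subIsetr.
rewrite setIC (Ldist LN LR LM); apply/(join_subP _ _ LJ); split.
  by apply: subset_trans (@join_subl R (M `&` N)); exact: subIsetr.
by rewrite setIC; exact: join_subr.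
Qed.

Lemma join_bigcapT n R (K : 'I_n -> set X) : L R -> (forall i, L (K i)) ->
  (forall i, join L R (K i) = setT) -> join L R (\bigcap_i K i) = setT.
Proof.
move=> LR; elim: n K => [|n IH] K LK jK.
  rewrite (_ : \bigcap_i K i = setT); last by apply/seteqP; split=> // x _ [].
  by apply/seteqP; split => // x _; exact: join_subr.
have -> : \bigcap_i K i = K ord0 `&` \bigcap_i K (lift ord0 i).
  apply/seteqP; split=> x.
    by move=> h; split=> [|i _]; apply: h.
  by move=> [h0 h] i _; case: (unliftP ord0 i) => [j|] ->; [apply: h|].
apply/seteqP; split=> // x _; apply: joinIr => //; first exact: cs_bigcap.
by rewrite jK IH.
Qed.

Lemma setI_bigjoin n M (F : 'I_n -> set X) P : L M -> L P ->
  (forall i, L (F i)) -> (forall i, M `&` F i `<=` P) ->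
  M `&` bigjoin L F `<=` P.
Proof.
move=> LM LP; elim: n F => [|n IH] F LF h.
  suff hb : bigjoin L F `<=` P by apply: subset_trans hb; exact: subIsetr.
  by apply/bigjoin_subP => // -[].
have hb : bigjoin L F `<=` join L (F ord0) (bigjoin L (fun i => F (lift ord0 i))).
  apply/(bigjoin_subP _ (cs_smallest _)) => i.
  case: (unliftP ord0 i) => [j|] ->; last exact: join_subl.
  apply: subset_trans (@join_subr _ _).
  exact: (@bigjoin_sup _ (fun i => F (lift ord0 i)) j).
suff : M `&` join L (F ord0) (bigjoin L (fun i => F (lift ord0 i))) `<=` P.
  by apply: subset_trans => x [Mx /hb].
rewrite (Ldist LM (LF _) (cs_smallest _)); apply/(join_subP _ _ LP); split=> //.
by apply: IH.
Qed.

Lemma setI_join_sub M N N' P : L M -> L N -> L N' -> L P ->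
  M `&` N `<=` P -> M `&` N' `<=` P -> M `&` join L N N' `<=` P.
Proof. by move=> LM LN LN' LP h h'; rewrite Ldist //; apply/join_subP. Qed.

End ClosureSystemTheory.

Section BasicPreimage.
Variables (S T : b0Space) (f : basicMap S T).
Local Open Scope classical_set_scope.

Let LS := @basic_domain S.
Let LT := @basic_domain T.
Let clS : closure_system LS := @b0_closure_system S.
Let clT : closure_system LT := @b0_closure_system T.
Let diS : distributive LS := @b0_distributive S.
Let diT : distributive LT := @b0_distributive T.

Lemma neg_complement (U : b0Space) (C : set U) : closed_domain C ->
  is_complement (@basic_domain U) C (neg C).
Proof. by move=> /b0_complemented /complP. Qed.

Lemma basic_preimage_adjunction :
  set_adjunction LS LT (basic_image f) (basic_preimage f).
Proof.
split=> [A _|B _|]; [exact: cs_smallest|exact: cs_smallest|].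
have [f0 [g [gC gadj gneg gjoin]]] := basic_funP f.
move=> A B LA LB; split=> [h|h].
  by apply: sub_smallest => x Ax; exists A.
apply: smallest_sub => // _ [x /h hx <-].
have [F BE FE] := b0_generated LB; rewrite BE => P FP; have [n [C [D [CC CD eP]]]] := FE P FP.
rewrite eP; apply: gjoin => //; rewrite /basic_preimage in hx.
apply: hx; split; first exact: cs_smallest.
set R := bigjoin _ _; apply: bigcup_sub => M [LM fM].
have LR : LS R by exact: cs_smallest.
pose K i := neg (g (C i)) `&` g (D i).
have LK i : LS (K i).
  have [Ln _ _] := neg_complement (gC _ (CC i)).
  by apply: cs_setI => //; exact/b0_closed_basic/gC.
have LJi i : LS (join LS (g (C i)) (neg (g (D i)))) by exact: cs_smallest.
have subR i : join LS (g (C i)) (neg (g (D i))) `<=` R.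
  exact: (@bigjoin_sup _ LS _ (fun i => join LS (g (C i)) (neg (g (D i)))) i).
have jK i : join LS R (K i) = setT.
  have [Ln _ jn] := neg_complement (gC _ (CC i)).
  have [Ln' _ jn'] := neg_complement (gC _ (CD i)).
  apply/seteqP; split=> // y _; apply: joinIr => //.
    exact/b0_closed_basic/gC.
  have hC : setT `<=` join LS R (neg (g (C i))).
    rewrite -jn; apply/join_subP; [exact: cs_smallest|split; last exact: join_subr].
    apply: subset_trans (@join_subl _ LS _ _).
    by apply: subset_trans (subR i); exact: join_subl.
  have hD : setT `<=` join LS R (g (D i)).
    rewrite -jn'; apply/join_subP; [exact: cs_smallest|split; first exact: join_subr].
    apply: subset_trans (@join_subl _ LS _ _).
    by apply: subset_trans (subR i); exact: join_subr.
  by split; [apply: hC|apply: hD].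
have jRK := join_bigcapT clS diS LR LK jK.
have LKK : LS (\bigcap_i K i) by apply: cs_bigcap.
have : M `&` join LS R (\bigcap_i K i) `<=` R.
  apply: (setI_join_sub diS LM LR LKK LR); first by move=> y [].
  move=> y [My Ky]; apply: (bottom_sub LR); rewrite -/LS -f0 /preimage /=.
  have LQ i : LT (neg (C i) `&` D i).
    have [Ln _ _] := neg_complement (CC i).
    by apply: cs_setI => //; exact/b0_closed_basic/CD.
  have fyQ : (\bigcap_i (neg (C i) `&` D i)) (f y).
    move=> i _; have [nCy gDy] := Ky i Logic.I; split; first exact: (gneg _ (CC i)).
    by apply/((gadj _ _ (gC _ (CD i)) (CD i)).2 (@subset_refl _ _)); exists y.
  have fyP : P (f y).
    suff : B (f y) by rewrite BE; apply.
    apply: fM; apply: sub_gen_smallest; by exists y.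
  rewrite eP in fyP.
  have LQQ : LT (\bigcap_i (neg (C i) `&` D i)) by apply: cs_bigcap.
  apply: (setI_bigjoin clT diT LQQ (cs_smallest clT _) _ _ (conj fyQ fyP)).
    by move=> i; exact: cs_smallest.
  move=> i; have [Ln CN _] := neg_complement (CC i).
  have [Ln' DN _] := neg_complement (CD i).
  have LC := b0_closed_basic (CC i).
  apply: (setI_join_sub diT LQQ LC Ln' (cs_smallest clT _)).
    move=> z [/(_ i Logic.I) [nz _] Cz].
    by have : (C i `&` neg (C i)) z by []; rewrite CN.
  move=> z [/(_ i Logic.I) [_ Dz] nz].
  by have : (D i `&` neg (D i)) z by []; rewrite DN.
by rewrite jRK setIT.
Qed.

End BasicPreimage.

Section HeytingTheory.
Context {d : Order.disp_t} (H : heytingSemilatticeType d).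
Implicit Types (x y z u v a b t : H) (T M N P S : set H).
Local Notation "x ⊓ y" := (Order.meet x y) (at level 48, left associativity).
Local Notation "x ⇒ y" := (himp x y) (at level 55, right associativity).

Lemma imp_le x y z : (x <= y ⇒ z) = (x ⊓ y <= z).
Proof. by rewrite meetC himpP. Qed.

Lemma imp_mp x y : (x ⇒ y) ⊓ x <= y.
Proof. by rewrite -imp_le. Qed.

Lemma le_imp x y : y <= x ⇒ y.
Proof. by rewrite imp_le leIl. Qed.

Lemma imp_top x y : (x ⇒ y = \top) <-> (x <= y).
Proof.
split=> [e|xy]; first by rewrite -[x]meet1x -imp_le e.
by apply: le_anti; rewrite lex1 imp_le meet1x.
Qed.

Lemma top_imp x : \top ⇒ x = x.
Proof.
by apply: le_anti; rewrite le_imp andbT -[leLHS]meetx1; exact: imp_mp.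
Qed.

Lemma imp_imp x y z : x ⇒ (y ⇒ z) = (x ⊓ y) ⇒ z.
Proof.
apply: le_anti; apply/andP; split; rewrite !imp_le.
  by rewrite meetA; apply: le_trans (imp_mp y z); rewrite leI2 ?imp_mp.
by rewrite -meetA; exact: imp_mp.
Qed.

Lemma imp_idem x y : x ⇒ (x ⇒ y) = x ⇒ y.
Proof. by rewrite imp_imp meetxx. Qed.

Lemma open_setP a x : hs_open_set a x <-> a ⇒ x = x.
Proof. by split=> [[y _ <-]|<-]; [exact: imp_idem|exists x]. Qed.

Lemma dn_meet x z : z = (x ⇒ z) ⊓ ((x ⇒ z) ⇒ z).
Proof.
apply: le_anti; rewrite lexI !le_imp /=.
by rewrite meetC; exact: imp_mp.
Qed.

Lemma le_dn x z : x <= (x ⇒ z) ⇒ z.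
Proof. by rewrite imp_le meetC imp_mp. Qed.

Lemma ideal_closure : closure_system (@ideal d H).
Proof.
move=> F FI; split.
- by move=> S /FI [].
- by move=> x y hx hy S FS; have [_ + _] := FI _ FS; apply; [exact: hx|exact: hy].
- by move=> x t ht S FS; have [_ _ +] := FI _ FS; apply; exact: ht.
Qed.

Lemma ideal_bigmeet T (n : nat) (a : 'I_n -> H) : ideal T ->
  (forall i, T (a i)) -> T (\meet_(i < n) a i).
Proof. by move=> [T1 TI _] Ta; elim/big_ind: _. Qed.

Lemma ideal_closed_meet T a b : ideal T ->
  (hs_closed_set a `<=` T)%classic -> (hs_closed_set b `<=` T)%classic ->
  (hs_closed_set (a ⊓ b) `<=` T)%classic.
Proof.
move=> [_ TI _] ha hb z abz; rewrite (dn_meet a z); apply: TI.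
  by apply: hb; rewrite /hs_closed_set /= imp_le meetC.
by apply: ha; exact: le_dn.
Qed.

Lemma ideal_closed_bigmeet T (n : nat) (a : 'I_n -> H) : ideal T ->
  (forall i, hs_closed_set (a i) `<=` T)%classic ->
  (hs_closed_set (\meet_(i < n) a i) `<=` T)%classic.
Proof.
move=> Ti Ta; elim/big_ind: _ => // [z|x y hx hy].
  by rewrite /hs_closed_set /= le1x => /eqP ->; case: Ti.
exact: ideal_closed_meet.
Qed.

(* An explicit form of the joins in hs_elementary; see elemE. *)
Definition elem_set (n : nat) (a b : 'I_n -> H) : set H :=
  [set z | forall u, (forall i, u <= a i) -> (forall i, u <= b i ⇒ z) -> u <= z].

Lemma elem_ideal n (a b : 'I_n -> H) : ideal (elem_set a b).
Proof.
split=> [u _ _|x y hx hy u ua ub|x t ht u ua ub]; first exact: lex1.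
- rewrite lexI hx ?hy // => i; apply: le_trans (ub i) _;
  by rewrite imp_le (le_trans (imp_mp _ _)) // ?leIl ?leIr.
- rewrite imp_le; apply: ht => i; first by rewrite leIxl.
  by rewrite imp_le -meetA (meetC x) meetA -imp_le -imp_le.
Qed.

Lemma elem_min n (a b : 'I_n -> H) T : ideal T ->
  (forall i, hs_closed_set (a i) `<=` T)%classic ->
  (forall i, hs_open_set (b i) `<=` T)%classic ->
  (elem_set a b `<=` T)%classic.
Proof.
move=> Ti ha hb z hz; set w := \meet_(i < n) (b i ⇒ z).
have wb i : w <= b i ⇒ z by exact: meets_inf.
have zw : z <= w by apply/meetsP => i _; exact: le_imp.
have -> : z = w ⊓ (w ⇒ z).
  apply: le_anti; rewrite lexI zw le_imp /=.
  by rewrite meetC; exact: imp_mp.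
have [_ TI _] := Ti; apply: TI.
  by apply: ideal_bigmeet => // i; apply: hb; exists z.
apply: (ideal_closed_bigmeet Ti ha); rewrite /hs_closed_set /= imp_le.
apply: hz => i; first by apply: leIxl; exact: meets_inf.
by apply: leIxr.
Qed.

Lemma elemE n (a b : 'I_n -> H) :
  bigjoin ideal
    (fun i => join ideal (hs_closed_set (a i)) (hs_open_set (b i))) =
  elem_set a b.
Proof.
have cl := ideal_closure; apply/seteqP; split.
  apply/(bigjoin_subP _ (elem_ideal a b)) => i.
  apply/(join_subP _ _ (elem_ideal a b)); split=> z hz u ua ub.
    exact: le_trans (ua i) hz.
  by have/open_setP <- := hz.
apply: elem_min => [|i|i]; first exact: cs_smallest.
  apply: subset_trans (@bigjoin_sup _ _ _ _ i); exact: join_subl.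
apply: subset_trans (@bigjoin_sup _ _ _ _ i); exact: join_subr.
Qed.

Lemma elem_elementary n (a b : 'I_n -> H) : hs_elementary (elem_set a b).
Proof. by exists n, a, b; rewrite elemE. Qed.

Lemma elementaryP S : hs_elementary S ->
  exists n (a b : 'I_n -> H), S = elem_set a b.
Proof. by move=> [n [a [b ->]]]; exists n, a, b; rewrite elemE. Qed.

Lemma elementary_basic S : hs_elementary S -> hs_basic H S.
Proof. by move=> eS; exists [set S]; [move=> _ ->|rewrite bigcap_set1]. Qed.

Lemma elem_basic n (a b : 'I_n -> H) : hs_basic H (elem_set a b).
Proof. exact/elementary_basic/elem_elementary. Qed.

Lemma basic_ideal M : hs_basic H M -> ideal M.
Proof.
move=> [F FE ->]; apply: ideal_closure => S /FE /elementaryP [n [a [b ->]]].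
exact: elem_ideal.
Qed.

Lemma basic_closure : closure_system (hs_basic H).
Proof.
move=> G GB.
exists [set S | hs_elementary S /\ exists2 M, G M & (M `<=` S)%classic].
  by move=> S [].
apply/seteqP; split=> [x hx S [_ [M GM]]|x hx M GM].
  by apply; exact: hx.
have [F FE eM] := GB _ GM; rewrite eM => S FS; apply: hx.
by split; [exact: FE|exists M => //; rewrite eM => y; apply].
Qed.

Lemma elem_cat n m (a b : 'I_n -> H) (a' b' : 'I_m -> H) :
  exists E, [/\ hs_basic H E, (elem_set a b `<=` E)%classic,
    (elem_set a' b' `<=` E)%classic &
    forall z u, E z -> (forall i, u <= a i) -> (forall i, u <= b i ⇒ z) ->
      (forall i, u <= a' i) -> (forall i, u <= b' i ⇒ z) -> u <= z].
Proof.
pose c (f : 'I_n -> H) (g : 'I_m -> H) (i : 'I_(n + m)) :=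
  match split i with inl j => f j | inr j => g j end.
have cl f g i : c f g (lshift m i) = f i by rewrite /c (unsplitK (inl i)).
have cr f g i : c f g (rshift n i) = g i by rewrite /c (unsplitK (inr i)).
exists (elem_set (c a a') (c b b')); split; first exact: elem_basic.
- move=> z hz u ua ub; apply: hz => i.
    by have := ua (lshift m i); rewrite cl.
  by have := ub (lshift m i); rewrite cl.
- move=> z hz u ua ub; apply: hz => i.
    by have := ua (rshift n i); rewrite cr.
  by have := ub (rshift n i); rewrite cr.
- move=> z u hz ua ub ua' ub'; apply: hz => i; rewrite /c; by case: split.
Qed.

Lemma basic_sub_distr M N P S : hs_basic H M -> hs_basic H N -> hs_basic H P ->
  hs_basic H S -> (M `&` N `<=` S)%classic -> (M `&` P `<=` S)%classic ->
  (M `&` join (hs_basic H) N P `<=` S)%classic.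
Proof.
move=> BM BN BP [F FE eS] hN hP x [Mx Jx].
have [_ _ MI] := basic_ideal BM.
have BJ : hs_basic H (join (hs_basic H) N P) by exact: (cs_smallest basic_closure).
have [_ _ JI] := basic_ideal BJ.
rewrite eS => Q FQ.
have [n [a [b eQ]]] := elementaryP (FE _ FQ); rewrite eQ => u ua ub.
have SQ y : S y -> elem_set a b y by rewrite -eQ eS; apply.
set x' := u ⇒ x.
have key w : elem_set a b (w ⇒ x') -> w ⇒ x' = \top.
  move=> hw; apply/imp_top; suff : u <= w ⇒ x'.
    by rewrite !imp_le meetAC meetxx meetC.
  apply: hw => // i; rewrite imp_le.
  have := ub i; rewrite imp_le => /le_trans; apply.
  by apply: le_trans (le_imp _ _); exact: le_imp.
have Nkey w : N (w ⇒ x') -> w ⇒ x' = \top.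
  by move=> Nw; apply/key/SQ/hN; split => //; exact: (MI _ _ (MI _ _ Mx)).
have Pkey w : P (w ⇒ x') -> w ⇒ x' = \top.
  by move=> Pw; apply/key/SQ/hP; split => //; exact: (MI _ _ (MI _ _ Mx)).
have Jx' : join (hs_basic H) N P x' by exact: JI.
apply/imp_top; rewrite -/x' -[x']top_imp; apply: Pkey; rewrite top_imp.
have [FP FPE eP] := BP; rewrite eP => R FPR.
have [m [a' [b' eR]]] := elementaryP (FPE _ FPR); rewrite eR => v va vb.
apply/imp_top; apply: Nkey.
have [FN FNE eN] := BN; rewrite eN => R2 FNR2.
have [k [a2 [b2 eR2]]] := elementaryP (FNE _ FNR2); rewrite eR2 => w wa wb.
have [E [BE E2 E' Emem]] := elem_cat a2 b2 a' b'.
have JE : (join (hs_basic H) N P `<=` E)%classic.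
  apply/(join_subP _ _ BE); split=> z.
    by rewrite eN => /(_ _ FNR2); rewrite eR2; exact: E2.
  by rewrite eP => /(_ _ FPR); rewrite eR; exact: E'.
rewrite imp_le; apply: Emem; first exact: JE.
- by move=> i; rewrite leIxl.
- by move=> i; move: (wb i); rewrite !imp_le (meetAC w).
- by move=> i; rewrite leIxr.
- by move=> i; rewrite leIxr.
Qed.

Lemma basic_distributive : distributive (hs_basic H).
Proof.
move=> M N P BM BN BP; apply/seteqP; split.
  apply: basic_sub_distr => //; first exact: (cs_smallest basic_closure).
    exact: join_subl.
  exact: join_subr.
have BJ : hs_basic H (join (hs_basic H) N P) by exact: (cs_smallest basic_closure).
apply/join_subP; first exact: (cs_setI basic_closure).
by split=> x [Mx hx]; split=> //; [exact: join_subl|exact: join_subr].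
Qed.

Lemma basic_join G : hs_basic H (smallest ideal G) ->
  smallest (hs_basic H) G = smallest ideal G.
Proof.
move=> BG; apply/seteqP; split; last first.
  by apply: sub_smallest2l => M /basic_ideal.
by apply: smallest_sub => //; exact: sub_gen_smallest.
Qed.

Lemma ideal_joinE a b :
  join ideal (hs_closed_set a) (hs_open_set b) =
  elem_set (fun _ : 'I_1 => a) (fun _ => b).
Proof.
rewrite -elemE /bigjoin; apply/seteqP; split.
  by apply: sub_smallest => x hx; exists ord0.
apply: smallest_sub; first exact: (cs_smallest ideal_closure).
by move=> x [i _].
Qed.

Lemma basic_elemE n (a b : 'I_n -> H) :
  bigjoin (hs_basic H)
    (fun i => join (hs_basic H) (hs_closed_set (a i)) (hs_open_set (b i))) =
  elem_set a b.
Proof.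
rewrite -elemE /bigjoin basic_join.
  congr smallest; apply: eq_bigcupr => i _.
  by rewrite /join basic_join // -/(join _ _ _) ideal_joinE; exact: elem_basic.
rewrite (_ : smallest _ _ = elem_set a b); first exact: elem_basic.
rewrite -elemE; congr smallest; apply: eq_bigcupr => i _.
by rewrite /join basic_join // -/(join _ _ _) ideal_joinE; exact: elem_basic.
Qed.

Lemma closed_basic a : hs_basic H (hs_closed_set a).
Proof.
exists [set S | exists b, S = elem_set (fun _ : 'I_1 => a) (fun _ => b)].
  by move=> _ [b ->]; exact: elem_elementary.
apply/seteqP; split=> [x ax _ [b ->] u ua _|x hx].
  exact: le_trans (ua ord0) ax.
have := hx _ (ex_intro _ x erefl) a (fun=> lexx _); apply=> _.
by rewrite (imp_top x x).2.
Qed.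

Lemma open_basic b : hs_basic H (hs_open_set b).
Proof.
rewrite (_ : hs_open_set b = elem_set (fun _ : 'I_1 => \top) (fun _ => b)).
  exact: elem_basic.
apply/seteqP; split=> x.
  by move=> /open_setP e u _ /(_ ord0); rewrite e.
move=> hx; apply/open_setP/le_anti; rewrite le_imp andbT.
by apply: hx => _; rewrite ?lex1.
Qed.

Lemma basic_bottom : bottom (hs_basic H) = [set \top].
Proof.
apply/seteqP; split; last first.
  by move=> _ -> M [/basic_ideal [] ].
rewrite (_ : [set \top] = hs_closed_set \top).
  by apply: bottom_sub; exact: closed_basic.
by apply/seteqP; split=> x; rewrite /hs_closed_set /= le1x; move/eqP.
Qed.

Lemma closed_open_complement a :
  is_complement (hs_basic H) (hs_closed_set a) (hs_open_set a).
Proof.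
split; first exact: open_basic.
  rewrite basic_bottom; apply/seteqP; split=> x.
    by move=> [/imp_top + /open_setP <-].
  by move=> ->; split; [exact: lex1|apply/open_setP/imp_top/lex1].
apply/seteqP; split=> // x _.
rewrite /join basic_join -/(join _ _ _) ideal_joinE; last exact: elem_basic.
move=> u /(_ ord0) ua /(_ ord0) ux.
by apply: le_trans (imp_mp a x); rewrite lexI ux ua.
Qed.

Lemma closed_compl a : compl (hs_basic H) (hs_closed_set a) = hs_open_set a.
Proof.
exact: (complE basic_distributive (closed_basic a) (closed_open_complement a)).
Qed.

Lemma hs_closed_basic : (hs_closeds H `<=` hs_basic H)%classic.
Proof. by move=> _ [a _ <-]; exact: closed_basic. Qed.

Lemma hs_complemented C :
  hs_closeds H C -> exists N, is_complement (hs_basic H) C N.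
Proof.
by move=> [a _ <-]; exists (hs_open_set a); exact: closed_open_complement.
Qed.

Lemma hs_generated M : hs_basic H M ->
  exists2 F : set (set H), M = \bigcap_(S in F) S &
    forall S, F S -> exists (n : nat) (C D : 'I_n -> set H),
      [/\ forall i, hs_closeds H (C i), forall i, hs_closeds H (D i) &
          S = bigjoin (hs_basic H)
                (fun i => join (hs_basic H) (C i) (compl (hs_basic H) (D i)))].
Proof.
move=> [F FE ->]; exists F => // S /FE /elementaryP [n [a [b ->]]].
exists n, (hs_closed_set \o a), (hs_closed_set \o b); split.
- by move=> i; exists (a i).
- by move=> i; exists (b i).
rewrite -basic_elemE /=; congr bigjoin; apply/funext => i.
by rewrite closed_compl.
Qed.

Definition hs_b0 : b0Space := B0Space basic_closure basic_distributive
  hs_closed_basic hs_complemented hs_generated.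

End HeytingTheory.

Section ContinuousBasic.
Context {d1 d2 : Order.disp_t}.
Variables (H1 : heytingSemilatticeType d1) (H2 : heytingSemilatticeType d2).

Lemma adjoint_imp (f : H1 -> H2) (fs : H2 -> H1) :
  adjoint fs f -> {morph fs : x y / (x `&` y)%O} ->
  forall b x, f (himp (fs b) x) = himp b (f x).
Proof.
move=> adj fI b x; have h y : (y <= f (himp (fs b) x)) = (y <= himp b (f x)).
  by rewrite -adj !imp_le -fI adj.
by apply: le_anti; rewrite -h lexx h lexx.
Qed.

Lemma continuous_basic (f : H1 -> H2) : hs_continuous f ->
  @basic_continuous (hs_b0 H1) (hs_b0 H2) f.
Proof.
move=> [fs [adj f1 fI]].
have fimp := adjoint_imp adj fI.
split.
  rewrite /= !basic_bottom; apply/seteqP; split=> x /=.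
    by move=> fx; apply: le_anti; rewrite lex1 -f1 adj fx lex1.
  by move=> ->; apply: le_anti; rewrite lex1 -adj lex1.
pose g (C : set H2) : set H1 :=
  \bigcup_(b in [set b | C = hs_closed_set b]) hs_closed_set (fs b).
have gE b : g (hs_closed_set b) = hs_closed_set (fs b).
  apply/seteqP; split=> [x [b' /= e]|x hx]; last by exists b.
  suff -> : b = b' by [].
  apply: le_anti; apply/andP; split.
    by have : hs_closed_set b' b' := lexx b'; rewrite -e.
  by have : hs_closed_set b b := lexx b; rewrite e.
exists g; split.
- by move=> _ [b _ <-]; rewrite gE; exists (fs b).
- move=> _ _ [a _ <-] [b _ <-]; rewrite gE; split=> [h x ax|h _ [x ax <-]].
    apply: le_trans ax; rewrite adj; apply: (h (f a)).
    by exists a => //; exact: lexx.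
  by have := h x ax; rewrite /hs_closed_set /= adj.
- move=> _ [b _ <-]; rewrite gE /neg /= !closed_compl => x /open_setP e.
  by apply/open_setP; rewrite -fimp e.
- move=> n C D hC hD.
  have /choice [c eC] i : exists a : H2, C i = hs_closed_set a.
    by have [a _ <-] := hC i; exists a.
  have /choice [e eD] i : exists a : H2, D i = hs_closed_set a.
    by have [a _ <-] := hD i; exists a.
  rewrite (funext eC) (funext eD).
  have -> : (fun i => join (hs_basic H1) (g (hs_closed_set (c i)))
      (@neg (hs_b0 H1) (g (hs_closed_set (e i))))) =
      (fun i => join (hs_basic H1) (hs_closed_set (fs (c i)))
                  (hs_open_set (fs (e i)))).
    by apply/funext => i; rewrite !gE /neg /= closed_compl.
  have -> : (fun i => join (hs_basic H2) (hs_closed_set (c i))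
      (@neg (hs_b0 H2) (hs_closed_set (e i)))) =
      (fun i => join (hs_basic H2) (hs_closed_set (c i)) (hs_open_set (e i))).
    by apply/funext => i; rewrite /neg /= closed_compl.
  rewrite /= !basic_elemE => x hx u ua ub; rewrite -adj; apply: hx => i.
    by rewrite adj (le_trans (ua i)) // -adj.
  by rewrite adj fimp.
Qed.

Definition continuous_basicMap (f : H1 -> H2) (hf : hs_continuous f) :
    basicMap (hs_b0 H1) (hs_b0 H2) :=
  BasicMap (continuous_basic hf).

End ContinuousBasic.

(* Main.v *)
Require Import Defs.
From mathcomp Require Import all_boot all_order.
From mathcomp Require Import boolp classical_sets.

(** The map [a |-> o a] identifies [H] with the poset [o H] as a
meet-semilattice ([sub_open_set], [open_setI]), and under this identification
the basic preimage of open sets is [fs] ([basic_preimage_open_set]).  Hence a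
left adjoint on open sets satisfying the displayed intersection law is the same
thing as a left adjoint [fl] of [fs] satisfying Frobenius reciprocity
[fl (a /\ fs b) = fl a /\ b], which by adjointness says that [fs] preserves
implication.

Openness enters as follows.  If [fs] has a left adjoint [fl] and preserves
implication, then [f] maps [o a] onto [o (fl a)] ([open_set_image]), so [f] is
open; an open set is its own basic image, so [f] is then basic open.
Conversely, for a basic open map the basic image, which is left adjoint to the
basic preimage on all basic domains, restricts to open sets.  It satisfies the
intersection law because intersecting with [o b] is adjoint to joining with the
complement [c b]: one only has to check that [f] maps [o a] into [c b \/ o c]
as soon as it maps [o a /\ o (fs b)] into [o c] ([image_sub_elem]). *)

Local Open Scope classical_set_scope.
Local Open Scope order_scope.

Import Order.TTheory.

(** * Open sets of a Heyting semilattice *)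

Section OpenSets.
Context {d : Order.disp_t} {H : heytingSemilatticeType d}.

Lemma sub_open_set (a b : H) :
  (hs_open_set a `<=` hs_open_set b)%classic <-> a <= b.
Proof.
split=> [sab|ab x /open_setP ax].
  (* The test element a -> b of o a is in o b only if it is the top. *)
  have /open_setP e : hs_open_set b (himp a b) by apply: sab; exists b.
  by apply/imp_top; rewrite -e; apply/imp_top/le_imp.
by apply/open_setP; rewrite -ax imp_imp (meet_r ab).
Qed.

Lemma open_set_inj : injective (@hs_open_set d H).
Proof.
by move=> a b e; apply: le_anti; apply/andP; split; apply/sub_open_set;
   rewrite e.
Qed.

Lemma open_setI (a b : H) :
  (hs_open_set a `&` hs_open_set b)%classic = hs_open_set (a `&` b)%O.
Proof.
apply/seteqP; split=> x.
  by move=> [/open_setP ax /open_setP bx]; apply/open_setP; rewrite -imp_imp bx.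
by move=> hx; split; apply: (sub_open_set _ _).2 hx; rewrite ?leIl ?leIr.
Qed.

Lemma open_domainE (U : set H) : @open_domain (hs_b0 H) U <-> hs_opens H U.
Proof.
split=> [[_ [a _ <-] <-]|[a _ <-]].
  by exists a => //; rewrite /neg closed_compl.
by exists (hs_closed_set a); [exists a|rewrite /neg closed_compl].
Qed.

(** The [elem_set] of a single pair is the explicit form of the join
[c b \/ o c], and intersecting it with [o b] cancels [c b], the complement of
[o b]. *)
Lemma elem_set_open_set (b c : H) :
  (elem_set (fun _ : 'I_1 => b) (fun _ => c) `&` hs_open_set b
     `<=` hs_open_set c)%classic.
Proof.
move=> z [hz /open_setP bz]; apply/open_setP/le_anti; rewrite le_imp andbT.
by rewrite -{2}bz imp_le; apply: hz => _; rewrite ?leIl ?leIr.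
Qed.

End OpenSets.

(** * Basic images and preimages of open sets *)

Section ContinuousMaps.
Context {d1 d2 : Order.disp_t}.
Context {H1 : heytingSemilatticeType d1} {H2 : heytingSemilatticeType d2}.
Context {f : H1 -> H2} (hf : hs_continuous f).
Context {fs : H2 -> H1} (hfs : adjoint fs f).

Lemma continuous_adjoint : fs \top = \top /\ {morph fs : x y / (x `&` y)%O}.
Proof.
have [g [hg g1 gI]] := hf; suff -> : fs = g by [].
by apply/funext => b; apply: le_anti; rewrite hfs -hg lexx hg -hfs lexx.
Qed.

Lemma continuous_imp (b : H2) (x : H1) : f (himp (fs b) x) = himp b (f x).
Proof. by have [_ fsI] := continuous_adjoint; exact: (adjoint_imp hfs fsI). Qed.

Lemma continuous_eq_top (x : H1) : f x = \top <-> x = \top.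
Proof.
have [fs1 _] := continuous_adjoint.
by split=> e; apply: le_anti; rewrite lex1 /=; [rewrite -fs1 hfs e|rewrite -hfs e].
Qed.

Lemma basic_image_subP (M : set H1) (N : set H2) : hs_basic H2 N ->
  (basic_image (continuous_basicMap hf) M `<=` N <-> f @` M `<=` N)%classic.
Proof.
move=> BN; split=> [h|h]; last exact: smallest_sub.
by apply: subset_trans h; exact: sub_gen_smallest.
Qed.

(** The inclusion in [o (fs b)] is tested on an ideal [M]: for [x] in [M] also
[y = (fs b -> x) -> x] is in [M], and [b -> f y] is the top, so [f y] in [o b]
forces [y] to be the top, which means [fs b -> x <= x]. *)
Lemma image_sub_open_set (M : set H1) (b : H2) : ideal M ->
  (f @` M `<=` hs_open_set b <-> M `<=` hs_open_set (fs b))%classic.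
Proof.
move=> [_ _ MI]; split=> [fM x Mx|MO _ [x /MO /open_setP bx <-]]; last first.
  by apply/open_setP; rewrite -continuous_imp bx.
apply/open_setP/le_anti; rewrite le_imp andbT.
set y := himp (himp (fs b) x) x.
have /open_setP : hs_open_set b (f y) by apply: fM; exists y => //; exact: MI.
rewrite -continuous_imp /y imp_imp (imp_top _ x).2; last by rewrite meetC imp_mp.
by rewrite (continuous_eq_top _).2 // => /esym /continuous_eq_top /imp_top.
Qed.

Lemma basic_preimage_open_set (b : H2) :
  basic_preimage (continuous_basicMap hf) (hs_open_set b) = hs_open_set (fs b).
Proof.
have [_ Bpre adj] := basic_preimage_adjunction (continuous_basicMap hf).
have Bb := open_basic b; have Bfb := open_basic (fs b).
have key M : hs_basic H1 M ->
    (M `<=` basic_preimage (continuous_basicMap hf) (hs_open_set b) <->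
     M `<=` hs_open_set (fs b))%classic.
  move=> BM; apply: iff_trans (iff_sym (adj _ _ BM Bb)) _.
  apply: iff_trans (basic_image_subP _ _ Bb) _.
  exact/image_sub_open_set/basic_ideal.
by apply/seteqP; split; apply/key => //; exact: Bpre.
Qed.

(** Every [f x] is the meet of [b -> f x], which is the image of [fs b -> x] in
[o a /\ o (fs b)], and of [(b -> f x) -> f x >= b]; so it is in the join of
[o c] and [c b]. *)
Lemma image_sub_elem (a : H1) (b c : H2) :
  (f @` hs_open_set (a `&` fs b)%O `<=` hs_open_set c)%classic ->
  (f @` hs_open_set a `<=` elem_set (fun _ : 'I_1 => b) (fun _ => c))%classic.
Proof.
move=> hc _ [x /open_setP ax <-] u /(_ ord0) ub /(_ ord0) ucx.
have /open_setP : hs_open_set c (himp b (f x)).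
  apply: hc; exists (himp (fs b) x); last exact: continuous_imp.
  by apply/open_setP; rewrite imp_imp -meetA meetxx meetC -imp_imp ax.
rewrite imp_imp meetC -imp_imp => e.
have : u <= himp b (f x) by rewrite -e imp_le leIxl.
by rewrite imp_le (meet_l ub).
Qed.

Lemma adjoint_frobenius (fl : H1 -> H2) : adjoint fl fs ->
  (forall a b, fl (a `&` fs b)%O = (fl a `&` b)%O) ->
  forall b c, fs (himp b c) = himp (fs b) (fs c).
Proof.
move=> hfl frob b c.
have h x : (x <= fs (himp b c)) = (x <= himp (fs b) (fs c)).
  by rewrite -hfl !imp_le -frob hfl.
by apply: le_anti; rewrite -h lexx h lexx.
Qed.

(** Since [fs] preserves implication, [z = f (a -> fs z)] for every [z] in
[o (fl a)]: both sides have the same lower bounds. *)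
Lemma open_set_image (fl : H1 -> H2) : adjoint fl fs ->
  (forall b c, fs (himp b c) = himp (fs b) (fs c)) ->
  forall a, f @` hs_open_set a = hs_open_set (fl a).
Proof.
move=> hfl fsimp a; apply/seteqP; split=> [_ [x /open_setP ax <-]|z /open_setP az].
  apply/open_setP; rewrite -continuous_imp -{1}ax imp_imp meet_r ?ax //.
  by rewrite -hfl.
exists (himp a (fs z)); first by exists (fs z).
have h y : (y <= f (himp a (fs z))) = (y <= z).
  rewrite -hfs imp_le meetC -imp_le -fsimp -hfl imp_le meetC -imp_le.
  by rewrite az.
by apply: le_anti; rewrite -h lexx h lexx.
Qed.

Lemma open_basic_open : hs_open f -> basic_open (continuous_basicMap hf).
Proof.
move=> fo _ /open_domainE [a _ <-]; apply/open_domainE.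
have [c _ e] := fo a; exists c => //.
apply/seteqP; split; first by rewrite e; exact: sub_gen_smallest.
by apply: smallest_sub; [exact: open_basic|rewrite e].
Qed.

Lemma basic_open_adjunction : basic_open (continuous_basicMap hf) ->
  exists h : set H1 -> set H2,
    set_adjunction (hs_opens H1) (hs_opens H2) h
      (basic_preimage (continuous_basicMap hf)) /\
    forall (a : H1) (b : H2),
      h (hs_open_set a `&`
         basic_preimage (continuous_basicMap hf) (hs_open_set b))%classic =
      (h (hs_open_set a) `&` hs_open_set b)%classic.
Proof.
move=> fo; exists (basic_image (continuous_basicMap hf)).
have [_ _ adj] := basic_preimage_adjunction (continuous_basicMap hf).
have imo a : hs_opens H2 (basic_image (continuous_basicMap hf) (hs_open_set a)).
  by apply/open_domainE/fo/open_domainE; exists a.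
split.
  split=> [_ [a _ <-]|_ [b _ <-]|_ _ [a _ <-] [b _ <-]]; first exact: imo.
    by rewrite basic_preimage_open_set; exists (fs b).
  by apply: adj; exact: open_basic.
move=> a b; rewrite basic_preimage_open_set open_setI.
have [c _ ec] := imo (a `&` fs b)%O.
apply/seteqP; split.
  rewrite subsetI; split.
    apply: sub_smallest2r; first exact: (cs_smallest (@basic_closure _ H2)).
    apply: image_subset.
    by apply/sub_open_set; exact: leIl.
  apply/(basic_image_subP _ _ (open_basic b)).
  apply/image_sub_open_set; first exact/basic_ideal/open_basic.
  by apply/sub_open_set; exact: leIr.
rewrite -ec; apply: subset_trans (@elem_set_open_set _ _ b c); apply: setSI.
apply/(basic_image_subP _ _ (elem_basic _ _))/image_sub_elem.
by rewrite ec; exact: sub_gen_smallest.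
Qed.

Lemma open_set_adjunction_frobenius (h : set H1 -> set H2) :
  set_adjunction (hs_opens H1) (hs_opens H2) h
    (basic_preimage (continuous_basicMap hf)) ->
  (forall (a : H1) (b : H2),
     h (hs_open_set a `&`
        basic_preimage (continuous_basicMap hf) (hs_open_set b))%classic =
     (h (hs_open_set a) `&` hs_open_set b)%classic) ->
  exists fl : H1 -> H2, adjoint fl fs /\
    forall (a : H1) (b : H2), fl (a `&` fs b)%O = (fl a `&` b)%O.
Proof.
move=> [ho _ adj] hI.
have /choice [fl hfl] a : exists c, h (hs_open_set a) = hs_open_set c.
  by have [c _ <-] := ho _ (imageT hs_open_set a); exists c.
exists fl; split=> [a b|a b]; last first.
  apply: open_set_inj.
  by rewrite -hfl -open_setI -basic_preimage_open_set hI hfl open_setI.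
have := adj _ _ (imageT hs_open_set a) (imageT hs_open_set b).
rewrite hfl basic_preimage_open_set => e.
by apply/idP/idP => /sub_open_set /e /sub_open_set.
Qed.

End ContinuousMaps.

(** * The equivalence *)

Theorem theorem9p3 (d1 d2 : Order.disp_t) (H1 : heytingSemilatticeType d1)
    (H2 : heytingSemilatticeType d2) (f : H1 -> H2) (hf : hs_continuous f)
    (fs : H2 -> H1) (hfs : adjoint fs f) :
  [<-> hs_open f;
       basic_open (continuous_basicMap hf);
       exists h : set H1 -> set H2,
         set_adjunction (hs_opens H1) (hs_opens H2) h
           (basic_preimage (continuous_basicMap hf)) /\
         forall (a : H1) (b : H2),
           h (hs_open_set a `&`
              basic_preimage (continuous_basicMap hf) (hs_open_set b))%classic =
           (h (hs_open_set a) `&` hs_open_set b)%classic;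
       exists fl : H1 -> H2, adjoint fl fs /\
         forall (a : H1) (b : H2), fl (a `&` fs b)%O = (fl a `&` b)%O;
       (exists fl : H1 -> H2, adjoint fl fs) /\
         forall b c : H2, fs (himp b c) = himp (fs b) (fs c)].
Proof.
tfae.
- exact: open_basic_open.
- exact: (basic_open_adjunction hf hfs).
- by move=> [h [hadj hI]]; exact: (open_set_adjunction_frobenius hf hfs h hadj hI).
- move=> [fl [hfl frob]]; split; first by exists fl.
  exact: adjoint_frobenius frob.
- move=> [[fl hfl] fsimp] a.
  by rewrite (open_set_image hf hfs fl hfl fsimp); exists (fl a).
Qed.
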